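(* Let $n\ge 2$, $\mathbf{x}\in\mathbb{R}^n$ and $\mathbf{B}_{\mathbf{x}}=\mathbf{C}_{\mathbf{x}}^\top\mathbf{C}_{\mathbf{x}}$. a) If $\mathbf{B}_{\mathbf{x}}^m\ge\mathbf{0}$ for some $m\in\mathbb{N}$, then $\mathbf{x}\in\mathcal{C}_n$. b) If $\mathbf{B}_{\mathbf{x}}^m>\mathbf{0}$ for some $m\in\mathbb{N}$, then $\mathbf{x}\in\mathcal{C}_n'$.
   Context: $\mathbb{N}=\{1,2,3,\dots\}$. For $\mathbf{x}=(x_0,\dots,x_{n-1})\in\mathbb{R}^n$, $\mathbf{C}_{\mathbf{x}}\in\mathbb{R}^{n\times n}$ is the circulant matrix with first row $(x_0,x_1,\dots,x_{n-1})$, each further row being the cyclic shift to the right by one position of the row above; i.e. the entry in row $j$, column $k$ ($0\le j,k\le n-1$) is $x_{(k-j)\bmod n}$. For a matrix $\mathbf{M}$, $\mathbf{M}\ge\mathbf{0}$ (resp. $\mathbf{M}>\mathbf{0}$) means that every entry of $\mathbf{M}$ is nonnegative (resp. positive). $\|\cdot\|$ denotes the spectral norm of a matrix (the matrix norm induced by the Euclidean norm). Let $c(t)=x_0+x_1t+\dots+x_{n-1}t^{n-1}$ and $\mathbb{T}_n=\{t\in\mathbb{C}:t^n=1\}$. Define $\mathcal{C}_n=\{\mathbf{x}\in\mathbb{R}^n:\ \|\mathbf{C}_{\mathbf{x}}\|=|x_0+x_1+\dots+x_{n-1}|\}$ and, for $n\ge2$, $\mathcal{C}_n'=\{\mathbf{x}\in\mathcal{C}_n:\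 \max_{t\in\mathbb{T}_n\setminus\{1\}}|c(t)|<|c(1)|\}$. *)

(* Defs.v *)
From HB Require Import structures.
From mathcomp Require Import all_boot all_order all_algebra.
From mathcomp Require Import complex.
From mathcomp Require Import boolp classical_sets reals.

Set Implicit Arguments.
Unset Strict Implicit.
Unset Printing Implicit Defensive.

Import Order.TTheory GRing.Theory Num.Theory.

Local Open Scope classical_set_scope.
Local Open Scope ring_scope.

Lemma cyc_subn_proof (n : nat) (k j : 'I_n) : ((k + (n - j)) %% n < n)%N.
Proof. by rewrite ltn_pmod // (leq_ltn_trans _ (ltn_ord k)). Qed.

(* (k - j) mod n; the subtraction n - j is exact since j < n. *)
Definition cyc_sub (n : nat) (k j : 'I_n) : 'I_n :=
  Ordinal (cyc_subn_proof k j).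

Definition circulant (R : realType) (n : nat) (x : 'rV[R]_n) : 'M[R]_n :=
  \matrix_(j, k) x ord0 (cyc_sub k j).

Definition eucl_norm (R : realType) (n : nat) (v : 'cV[R]_n) : R :=
  Num.sqrt (\sum_(i < n) v i ord0 ^+ 2).

Definition spectral_norm (R : realType) (m n : nat) (A : 'M[R]_(m, n)) : R :=
  sup [set eucl_norm (A *m v) | v in [set v : 'cV[R]_n | eucl_norm v <= 1]].

Definition circ_poly (R : realType) (n : nat) (x : 'rV[R]_n) : {poly R[i]} :=
  map_poly (real_complex R) (rVpoly x).

Definition calC (R : realType) (n : nat) : set 'rV[R]_n :=
  [set x | spectral_norm (circulant x) = `|\sum_(i < n) x ord0 i|].

(* For n >= 2 the set of n-th roots of unity other than 1 is finite and
   nonempty, so the maximum of |c(t)| over it is < |c(1)| exactly when every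
   |c(t)| is.  The norms and the order are those of R[i]. *)
Definition calC' (R : realType) (n : nat) : set 'rV[R]_n :=
  [set x | calC x /\ forall t : R[i], n.-unity_root t -> t != 1 ->
             `|(circ_poly x).[t]| < `|(circ_poly x).[1]| ].

(* Main.v *)
Require Import Defs.
From HB Require Import structures.
From mathcomp Require Import all_boot all_order all_algebra.
From mathcomp Require Import ring lra.
From mathcomp Require Import complex.
From mathcomp Require Import boolp classical_sets reals.

(** Write [s] for the sum of the entries of [x], [C] for the circulant
    matrix and [B = C^T C].

    The norm is handled over the reals, by quadratic forms. The constant
    vector is an eigenvector of [C] with eigenvalue [s], so [|s|] is a
    lower bound of the spectral norm, and the rows of [B^m] sum to
    [s^(2m)]. If [B^m] is nonnegative, the inequality [2ab <= a^2 + b^2]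
    weighted by its entries gives [v^T B^m v <= s^(2m) |v|^2]
    ([qform_schur]). To get from [B^m] down to [B], observe that [a_k =
    v^T B^k v] is log-convex because every [B^k] is positive semidefinite;
    so the ratios [a_(k+1) / a_k] increase, and [(a_1 / a_0)^m <= a_m /
    a_0 <= s^(2m)] ([logconvex_root]). Hence [|C v|^2 = a_1 <= s^2 |v|^2],
    which is the upper bound.

    For the strict inequality, let [t <> 1] be an [n]-th root of unity.
    The vector [(1, t, ..., t^(n-1))] is an eigenvector of [B^m] with
    eigenvalue [|c(t)|^(2m)], since the inverse of [t] is its conjugate
    ([gram_exp_geom]). Its zeroth coordinate displays this eigenvalue as a
    combination of the unit complex numbers [t^k] whose weights are the
    entries of a row of [B^m], hence are positive and sum to [s^(2m)].
    Taking real parts, each [t^k] contributes at most its weight, and [t]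
    itself strictly less ([Re_average_lt]). *)

Set Implicit Arguments.
Unset Strict Implicit.
Unset Printing Implicit Defensive.

Import Order.TTheory GRing.Theory Num.Theory.

Local Open Scope ring_scope.

(** * Eigenvectors of circulant matrices *)

Lemma modn_cyc_sub (n : nat) (k j : 'I_n) : (j + cyc_sub k j = k %[mod n])%N.
Proof. by rewrite /= modnDmr addnCA subnKC ?modnDr // ltnW. Qed.

Lemma cyc_sub_injl (n : nat) (j : 'I_n) : injective (fun k => cyc_sub k j).
Proof.
move=> k k' /= e; apply: val_inj.
by rewrite /= -(modn_small (ltn_ord k)) -(modn_small (ltn_ord k'))
  -(modn_cyc_sub k j) e modn_cyc_sub.
Qed.

Lemma cyc_sub_injr (n : nat) (j : 'I_n) : injective (cyc_sub j).
Proof.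
move=> k k' e; apply: val_inj.
have /eqP : (k + cyc_sub j k = k' + cyc_sub j k %[mod n])%N.
  by rewrite {2}e !modn_cyc_sub.
by rewrite eqn_modDr !modn_small ?ltn_ord // => /eqP.
Qed.

Lemma expr_eqmod (K : pzSemiRingType) (n : nat) (t : K) (i j : nat) :
  t ^+ n = 1 -> (i = j %[mod n])%N -> t ^+ i = t ^+ j.
Proof. by move=> tn1 e; rewrite -(expr_mod i tn1) e expr_mod. Qed.

(* The scalars are embedded in [K] by [f], so that one computation serves both
   the constant vector over the reals and the root-of-unity vectors over the
   complex numbers. *)
Section Eigen.
Variables (R : realType) (K : comNzRingType) (f : {rmorphism R -> K}).
Variables (n : nat) (x : 'rV[R]_n).

Definition symbol (t : K) : K := \sum_(i < n) f (x ord0 i) * t ^+ i.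

Definition geom_col (t : K) : 'cV[K]_n := \col_i t ^+ i.

(** Row [j] pairs the entry of index [k - j] with [t^k = t^j t^(k-j)]; the
    reduction of [k - j] modulo [n] is invisible because [t^n = 1]. *)
Lemma circulant_geom (t : K) : t ^+ n = 1 ->
  map_mx f (circulant x) *m geom_col t = symbol t *: geom_col t.
Proof.
move=> tn1; apply/colP=> j; rewrite !mxE mulr_suml.
rewrite [RHS](reindex_inj (@cyc_sub_injl n j)).
apply: eq_bigr => k _; rewrite !mxE -mulrA -exprD addnC.
by rewrite (@expr_eqmod _ n t _ k) // modn_cyc_sub.
Qed.

(** Transposing replaces the index [k - j] by [j - k], hence [t] by its inverse
    in the eigenvalue. *)
Lemma circulant_tr_geom (s t : K) : t ^+ n = 1 -> s * t = 1 ->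
  map_mx f (circulant x)^T *m geom_col t = symbol s *: geom_col t.
Proof.
move=> tn1 st1; apply/colP=> j; rewrite !mxE mulr_suml.
rewrite [RHS](reindex_inj (@cyc_sub_injr n j)).
apply: eq_bigr => k _; rewrite !mxE -mulrA; congr (_ * _).
rewrite -(@expr_eqmod _ n t _ j tn1 (modn_cyc_sub j k)) exprD mulrCA.
by rewrite -exprMn st1 expr1n mulr1.
Qed.

Lemma gram_exp_geom (s t : K) (m : nat) : t ^+ n = 1 -> s * t = 1 ->
  map_mx f (((circulant x)^T *m circulant x) ^+ m) *m geom_col t =
  (symbol s * symbol t) ^+ m *: geom_col t.
Proof.
move=> tn1 st1; elim: m => [|m IH].
  by rewrite !expr0 map_mx1 mul1mx scale1r.
rewrite exprS -mulmxE !map_mxM -mulmxA IH -scalemxAr -mulmxA circulant_geom //.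
rewrite -scalemxAr (circulant_tr_geom tn1 st1) !scalerA.
by rewrite exprSr (mulrC (symbol s)) !mulrA.
Qed.

End Eigen.

Lemma circ_polyE (R : realType) (n : nat) (x : 'rV[R]_n) (t : R[i]) :
  (circ_poly x).[t] = symbol (real_complex R) x t.
Proof.
rewrite /circ_poly (horner_coef_wide (n := n)); last first.
  by rewrite size_map_poly size_poly.
by apply: eq_bigr => i _; rewrite coef_map /= coef_rVpoly_ord.
Qed.

(** * Quadratic forms *)

Section Quadratic.
Variables (R : realType).

Definition qform (n : nat) (M : 'M[R]_n) (v : 'cV[R]_n) : R :=
  (v^T *m M *m v) ord0 ord0.

Lemma qformE (n : nat) (M : 'M[R]_n) (v : 'cV[R]_n) :
  qform M v = \sum_i \sum_j M i j * (v i ord0 * v j ord0).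
Proof.
rewrite /qform -mulmxA mxE; apply: eq_bigr => i _.
rewrite !mxE mulr_sumr; apply: eq_bigr => j _; ring.
Qed.

Lemma qform1E (n : nat) (v : 'cV[R]_n) : qform 1 v = \sum_i v i ord0 ^+ 2.
Proof.
by rewrite /qform mulmx1 mxE; apply: eq_bigr => i _; rewrite mxE expr2.
Qed.

Lemma qform1_ge0 (n : nat) (v : 'cV[R]_n) : 0 <= qform 1 v.
Proof. by rewrite qform1E sumr_ge0 // => i _; rewrite sqr_ge0. Qed.

Lemma qform_gram (n : nat) (C : 'M[R]_n) (v : 'cV[R]_n) :
  qform (C^T *m C) v = qform 1 (C *m v).
Proof. by rewrite /qform mulmx1 trmx_mul !mulmxA. Qed.

(** The Schur test for a symmetric matrix: bound each product [v_i v_j] by the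
    mean of the squares. *)
Lemma qform_schur (n : nat) (M : 'M[R]_n) (r : R) (v : 'cV[R]_n) :
  (forall i j, 0 <= M i j) -> M^T = M -> (forall i, \sum_j M i j = r) ->
  qform M v <= r * qform 1 v.
Proof.
move=> M0 Msym Mr.
(* Symmetry makes the column sums equal to [r] as well, so both halves of the
   mean of squares add up to the same amount. *)
have Ml : \sum_i \sum_j M i j * v i ord0 ^+ 2 = r * qform 1 v.
  rewrite qform1E mulr_sumr; apply: eq_bigr => i _.
  by rewrite -mulr_suml Mr.
have Mc : \sum_i \sum_j M i j * v j ord0 ^+ 2 = r * qform 1 v.
  rewrite -Ml exchange_big /=; apply: eq_bigr => i _; apply: eq_bigr => j _.
  by rewrite -{1}Msym mxE.
have -> : r * qform 1 v =
    \sum_i \sum_j M i j * ((v i ord0 ^+ 2 + v j ord0 ^+ 2) / 2).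
  transitivity ((r * qform 1 v + r * qform 1 v) / 2); first by field.
  rewrite -{1}Ml -Mc -big_split /= mulr_suml; apply: eq_bigr => i _.
  rewrite -big_split /= mulr_suml; apply: eq_bigr => j _; by field.
rewrite qformE; apply: ler_sum => i _; apply: ler_sum => j _.
apply: ler_wpM2l => //.
have := sqr_ge0 (v i ord0 - v j ord0); nra.
Qed.

Lemma trmx_gram_exp (n : nat) (C : 'M[R]_n) (m : nat) :
  ((C^T *m C) ^+ m)^T = (C^T *m C) ^+ m.
Proof.
elim: m => [|m IH]; first by rewrite expr0 trmx1.
by rewrite exprS -mulmxE trmx_mul IH trmx_mul trmxK mulmxE -exprSr exprS.
Qed.

(** Two factors of [B] can be absorbed into the vector, one on each side, which
    reduces the exponent to [0] or [1]. *)
Lemma qform_gram_exp_ge0 (n : nat) (C : 'M[R]_n) (k : nat) (v : 'cV[R]_n) :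
  0 <= qform ((C^T *m C) ^+ k) v.
Proof.
move: v; elim/ltn_ind: k => -[|[|k]] IH v.
- by rewrite expr0 qform1_ge0.
- by rewrite expr1 qform_gram qform1_ge0.
have := IH k (leqnSn _) (C^T *m C *m v).
by rewrite /qform exprSr exprS -!mulmxE !trmx_mul trmxK !mulmxA.
Qed.

(** The left side is nonnegative when [B^k] is positive semidefinite; read as a
    quadratic polynomial in [c], this is the Cauchy-Schwarz inequality between
    three consecutive moments of [v]. *)
Lemma qform_exp_shift (n : nat) (B : 'M[R]_n) (k : nat) (v : 'cV[R]_n) (c : R) :
  B^T = B ->
  qform (B ^+ k) (B *m v - c *: v) =
  qform (B ^+ k.+2) v - 2 * c * qform (B ^+ k.+1) v + c ^+ 2 * qform (B ^+ k) v.
Proof.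
move=> Bs; rewrite /qform.
have -> : (B *m v - c *: v)^T *m B ^+ k *m (B *m v - c *: v) =
    v^T *m B ^+ k.+2 *m v - c *: (v^T *m B ^+ k.+1 *m v)
    - c *: (v^T *m B ^+ k.+1 *m v) + c *: (c *: (v^T *m B ^+ k *m v)).
  have -> : (B *m v - c *: v)^T = v^T *m B - c *: v^T.
    by rewrite [LHS]raddfB /= trmx_mul Bs [(c *: v)^T]linearZ.
  rewrite mulmxBr !mulmxBl -!scalemxAr.
  have e1 : B ^+ k.+1 = B ^+ k *m B by rewrite exprSr.
  have e1' : B ^+ k.+1 = B *m B ^+ k by rewrite exprS.
  have e2 : B ^+ k.+2 = B *m B ^+ k *m B by rewrite exprSr e1'.
  rewrite e2 {1}e1 e1' -!scalemxAl !mulmxA opprB addrA.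
  by rewrite -!addrA; congr (_ + (_ + _)); rewrite addrC.
set P := v^T *m _ *m v; set Q := v^T *m _ *m v; set S := v^T *m _ *m v.
by move: P Q S => P Q S; rewrite !mxE; ring.
Qed.

End Quadratic.

(** The second hypothesis is log-convexity of [a] in a form that makes sense when
    terms vanish.  It makes the ratio of consecutive terms nondecreasing, so the
    first ratio is at most the geometric mean of the first [m] ratios. *)
Lemma logconvex_root (R : realFieldType) (a : nat -> R) :
  (forall k, 0 <= a k) ->
  (forall k c, 0 <= a k.+2 - 2 * c * a k.+1 + c ^+ 2 * a k) ->
  forall (m : nat) (r : R), (0 < m)%N -> 0 <= r -> a m <= r ^+ m * a 0 ->
  a 1 <= r * a 0.
Proof.
move=> a0 aq.
(* When [a k = 0] the quadratic degenerates to an affine function of [c], which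
   is negative for this large [c] unless [a k.+1 = 0]. *)
have azero k : a k = 0 -> a k.+1 = 0.
  move=> ak0; apply/eqP; rewrite eq_le a0 andbT leNgt; apply/negP => a1.
  have := aq k ((a k.+2 + 1) / a k.+1).
  rewrite ak0 mulr0 addr0 -mulrA divfK ?gt_eqF //.
  have := a0 k.+2; lra.
have cs k : a k.+1 ^+ 2 <= a k * a k.+2.
  have [ak0|akn0] := eqVneq (a k) 0; first by rewrite azero // ak0 expr0n mul0r.
  have ak : 0 < a k by rewrite lt0r akn0 a0.
  (* the minimiser of the quadratic in [c] *)
  have := aq k (a k.+1 / a k); rewrite -(pmulr_rge0 _ ak).
  suff -> : a k * (a k.+2 - 2 * (a k.+1 / a k) * a k.+1
      + (a k.+1 / a k) ^+ 2 * a k) = a k * a k.+2 - a k.+1 ^+ 2 by rewrite subr_ge0.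
  by field.
have ratio k : a 1 * a k <= a 0 * a k.+1.
  elim: k => [|k IH]; first by rewrite mulrC.
  have [ak0|akn0] := eqVneq (a k) 0.
    by rewrite (azero k ak0) mulr0 mulr_ge0.
  have ak : 0 < a k by rewrite lt0r akn0 a0.
  rewrite -(ler_pM2l ak); apply: (@le_trans _ _ (a 0 * a k.+1 ^+ 2)).
    have -> : a k * (a 1 * a k.+1) = a k.+1 * (a 1 * a k) by ring.
    have -> : a 0 * a k.+1 ^+ 2 = a k.+1 * (a 0 * a k.+1) by ring.
    exact: ler_wpM2l.
  by rewrite (mulrCA (a k)) ler_wpM2l.
have power m : a 1 ^+ m * a 0 <= a 0 ^+ m * a m.
  elim: m => [|m IH]; first by rewrite !expr0 !mul1r.
  rewrite !exprS -mulrA; apply: (le_trans (ler_wpM2l (a0 1) IH)).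
  have -> : a 1 * (a 0 ^+ m * a m) = a 0 ^+ m * (a 1 * a m) by ring.
  have -> : a 0 * a 0 ^+ m * a m.+1 = a 0 ^+ m * (a 0 * a m.+1) by ring.
  by rewrite ler_wpM2l ?exprn_ge0.
move=> m r m0 r0 am.
have [a00|a0n0] := eqVneq (a 0) 0; first by rewrite azero // a00 mulr0.
have a0p : 0 < a 0 by rewrite lt0r a0n0 a0.
rewrite -(ler_pXn2r m0) ?nnegrE ?mulr_ge0 // exprMn -(ler_pM2r a0p).
apply: (le_trans (power m)).
by rewrite -mulrA mulrCA ler_wpM2l ?exprn_ge0.
Qed.

(** * Spectral norm *)

Lemma eucl_normE (R : realType) (n : nat) (v : 'cV[R]_n) :
  eucl_norm v = Num.sqrt (qform 1 v).
Proof. by rewrite qform1E. Qed.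

(** The eigenvector, once normalised, shows that the bound on [C] is attained. *)
Lemma spectral_norm_eig (R : realType) (n : nat) (C : 'M[R]_n) (v : 'cV[R]_n)
    (r : R) :
  v != 0 -> C *m v = r *: v ->
  (forall u, qform 1 (C *m u) <= r ^+ 2 * qform 1 u) ->
  spectral_norm C = `|r|.
Proof.
move=> v0 Cv Cle.
have normZ c u : eucl_norm (c *: u : 'cV[R]_n) = `|c| * eucl_norm u.
  rewrite !eucl_normE -sqrtr_sqr -sqrtrM ?sqr_ge0 //; congr Num.sqrt.
  rewrite !qform1E mulr_sumr; apply: eq_bigr => i _.
  by rewrite mxE exprMn.
set E : set R := [set eucl_norm (C *m u) | u in [set u | eucl_norm u <= 1]]%classic.
have ub : ubound E `|r|.
  move=> _ [u /= u1 <-]; apply: (@le_trans _ _ (`|r| * eucl_norm u)).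
    rewrite !eucl_normE -sqrtr_sqr -sqrtrM ?sqr_ge0 //.
    exact: ler_wsqrtr.
  by rewrite ler_piMr.
have vn : 0 < eucl_norm v.
  rewrite eucl_normE sqrtr_gt0 lt0r qform1_ge0 andbT qform1E.
  rewrite psumr_eq0; last by move=> i _; rewrite sqr_ge0.
  apply: contra v0 => /allP v0; apply/eqP/colP => i; rewrite mxE.
  by have := v0 i (mem_index_enum i); rewrite sqrf_eq0 => /eqP.
have nw : eucl_norm ((eucl_norm v)^-1 *: v) = 1.
  by rewrite normZ gtr0_norm ?invr_gt0 // mulVf // gt_eqF.
have mem : E `|r|.
  exists ((eucl_norm v)^-1 *: v); first by rewrite /= nw.
  by rewrite -scalemxAr Cv scalerA mulrC -scalerA normZ nw mulr1.
rewrite /spectral_norm -/E.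
apply/eqP; rewrite eq_le; apply/andP; split.
  by apply: ge_sup => //; exists `|r|.
by apply: ub_le_sup => //; exists `|r|.
Qed.

(** * Averages of points of the unit circle *)

(** On the unit circle, real part [1] forces imaginary part [0]. *)
Lemma unit_Re_lt1 (R : realType) (t : R[i]) :
  `|t| = 1 -> t != 1 -> complex.Re t < 1.
Proof.
move=> t1 tn1; rewrite lt_neqAle; apply/andP; split; last first.
  have := normc_ge_Re t; rewrite t1 (_ : 1 = 1%:C%C) // lecR.
  exact: le_trans (ler_norm _).
apply: contra tn1 => /eqP re1.
have := add_Re2_Im2 t; rewrite t1 re1 expr1n expr1n.
case: t re1 {t1} => a b /= -> /(congr1 (@complex.Re _)) /= /eqP.
by rewrite -subr_eq0 addrAC subrr add0r sqrf_eq0 => /eqP ->.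
Qed.

Lemma Re_sum (R : realType) (I : finType) (a : I -> R) (z : I -> R[i]) :
  complex.Re (\sum_i (a i)%:C%C * z i) = \sum_i a i * complex.Re (z i).
Proof.
rewrite (big_morph (@complex.Re R) (id1 := 0) (op1 := +%R)) //; last by case=> ? ? [].
by apply: eq_bigr => i _; case: (z i) => u w /=; rewrite mul0r subr0.
Qed.

(** The strict triangle inequality in the form needed when the weighted sum is
    known to be real. *)
Lemma Re_average_lt (R : realType) (I : finType) (a : I -> R) (z : I -> R[i])
    (i0 : I) :
  (forall i, 0 < a i) -> (forall i, `|z i| = 1) -> z i0 != 1 ->
  complex.Re (\sum_i (a i)%:C%C * z i) < \sum_i a i.
Proof.
move=> a0 z1 zi0; rewrite Re_sum (bigD1 i0) //= [ltRHS](bigD1 i0) //=.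
apply: ltr_leD; first by rewrite gtr_pMr ?unit_Re_lt1.
apply: ler_sum => i _; rewrite ger_pMr //.
have [->|zi] := eqVneq (z i) 1; first by [].
by rewrite ltW // unit_Re_lt1.
Qed.

(** * Circulant matrices whose Gram matrix has a nonnegative power *)

Theorem theorem2p1 (R : realType) (n : nat) (hn : (2 <= n)%N) (x : 'rV[R]_n) :
  let B : 'M[R]_n := (circulant x)^T *m circulant x in
  ((exists m : nat, (1 <= m)%N /\ B ^+ m \is a mxOver Num.nneg) -> calC x) /\
  ((exists m : nat, (1 <= m)%N /\ B ^+ m \is a mxOver Num.pos) -> calC' x).
Proof.
move=> B; set s := \sum_(i < n) x ord0 i.
have sE (K : comNzRingType) (f : {rmorphism R -> K}) : symbol f x 1 = f s.
  by rewrite rmorph_sum; apply: eq_bigr => i _; rewrite expr1n mulr1.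
pose i0 : 'I_n := Ordinal (ltnW hn).
have rowsum m i : \sum_j (B ^+ m) i j = (s ^+ 2) ^+ m.
  have := gram_exp_geom idfun x m (expr1n _ n) (mul1r 1).
  rewrite sE map_mx_id // => /colP /(_ i); rewrite !mxE expr1n mulr1 expr2 => <-.
  by apply: eq_bigr => j _; rewrite mxE expr1n mulr1.
have partA :
    (exists m : nat, (1 <= m)%N /\ B ^+ m \is a mxOver Num.nneg) -> calC x.
  case=> m [m1 /mxOverP Bm].
  apply: (@spectral_norm_eig _ _ _ (geom_col n 1)).
  - apply/eqP => /colP /(_ i0); rewrite !mxE expr1n => /eqP.
    by rewrite oner_eq0.
  - have := circulant_geom idfun x (expr1n _ n).
    by rewrite sE map_mx_id.
  move=> u; rewrite -qform_gram.
  have := @logconvex_root R (fun k => qform (B ^+ k) u).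
  apply => [k|k c|||].
  - exact: qform_gram_exp_ge0.
  - rewrite -qform_exp_shift ?qform_gram_exp_ge0 //.
    by rewrite trmx_mul trmxK.
  - exact: m1.
  - exact: sqr_ge0.
  - apply: qform_schur => [i j||i].
    + exact: Bm.
    + exact: trmx_gram_exp.
    + exact: rowsum.
split=> // -[m [m1 /mxOverP Bm]]; split.
  apply: partA; exists m; split=> //; apply/mxOverP => i j.
  by have := Bm i j; rewrite posrE nnegrE => /ltW.
move=> t /unity_rootP tn1 tne1.
have tnorm : `|t| = 1.
  by apply/eqP; rewrite -(pexpr_eq1 (ltnW hn)) // -normrX tn1 normr1.
have tconj : t^*%C * t = 1 by rewrite mulrC -sqr_normc tnorm expr1n.
have cconj : symbol (real_complex R) x t^*%C = (symbol (real_complex R) x t)^*%C.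
  rewrite rmorph_sum; apply: eq_bigr => i _.
  by rewrite rmorphM rmorphXn /= oppr0.
have eig : (`|symbol (real_complex R) x t| ^+ 2) ^+ m =
    \sum_j ((B ^+ m) i0 j)%:C%C * t ^+ j.
  have := gram_exp_geom (real_complex R) x m tn1 tconj.
  move=> /colP /(_ i0); rewrite !mxE expr0 mulr1 cconj mulrC -sqr_normc => <-.
  by apply: eq_bigr => j _; rewrite !mxE.
have snorm : (`|(s%:C)%C| ^+ 2) ^+ m = (((s ^+ 2) ^+ m)%:C)%C.
  by rewrite sqr_normc conjc_real -rmorphM -expr2 -rmorphXn.
(* Both sides become nonnegative reals after raising to the power [2m], so the
   order on complex numbers reduces to comparing real parts. *)
rewrite !circ_polyE sE -(ltr_pXn2r (n := 2 * m)) ?nnegrE ?muln_gt0 //.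
have lhs_real : complex.Im ((`|symbol (real_complex R) x t| ^+ 2) ^+ m) = 0.
  by apply: ger0_Im; rewrite !exprn_ge0.
rewrite !exprM snorm ltcE lhs_real /= eqxx eig /=.
rewrite -(rowsum m i0); apply: (@Re_average_lt _ _ _ _ (Ordinal hn)).
- by move=> j; have := Bm i0 j; rewrite posrE.
- by move=> j; rewrite normrX tnorm expr1n.
- by rewrite expr1.
Qed.
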